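(* Let $M$ be a monoid with unit $1_M$ and let $A$ and $B$ be submonoids of $M$. Then $M$ is factorized by $A$ and $B$ if and only if there are maps of sets $l : M \to A$ and $r : M \to B$ such that: (i) $l(am) = a\,l(m)$ for all $a \in A$ and $m \in M$; (ii) $r(mb) = r(m)\,b$ for all $m \in M$ and $b \in B$; (iii) $r(a) = 1_M$ for all $a \in A$ and $l(b) = 1_M$ for all $b \in B$; (iv) $\mathsf{K}[l] \cap \mathsf{K}[r] = \mathsf{K}[\mathrm{Id}_M]$.
   Context: A monoid $M$ is factorized by its submonoids $A$ and $B$ if the multiplication map $A \times B \to M$, $(a,b) \mapsto ab$, is bijective. For a map of sets $f : X \to Y$, $\mathsf{K}[f] = \{(x_1,x_2) \in X \times X : f(x_1) = f(x_2)\}$; in particular $\mathsf{K}[\mathrm{Id}_M]$ is the diagonal of $M \times M$. *)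

(* Defs.v *)
From mathcomp Require Import all_boot.
From mathcomp Require Import boolp classical_sets.

Set Implicit Arguments.
Unset Strict Implicit.
Unset Printing Implicit Defensive.

Import Algebra.

Local Open Scope classical_set_scope.
Local Open Scope group_scope.

(* The [choiceType] structure carried by a [monoidType] is no restriction:
   [boolp] provides one classically for every type. A set [A : set M] is used
   as a type through the coercion [set_type], i.e. {x : M | x \in A}, and
   [val] is the inclusion of [A] in [M]. *)

Definition mul_map (M : monoidType) (A B : set M) (p : A * B) : M :=
  val p.1 * val p.2.

Definition factorized (M : monoidType) (A B : set M) : Prop :=
  bijective (@mul_map M A B).

Definition kernel_pair (X Y : Type) (f : X -> Y) : set (X * X) :=
  [set p | f p.1 = f p.2].

(* Main.v *)
Require Import Defs.
From mathcomp Require Import all_boot.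
From mathcomp Require Import boolp classical_sets.

Import Algebra.

Local Open Scope classical_set_scope.
Local Open Scope group_scope.

(** The maps [l] and [r] are the coordinates of a factorization. If each m is uniquely a product a
    b, put l(m) = a and r(m) = b: uniqueness, in the form of [bijective_mul_map_components], gives
    (i)-(iii), and existence gives (iv). Conversely, m |-> (l(m), r(m)) inverts multiplication. *)

Lemma bijective_mul_map_components (M : monoidType) (A B : set M)
    (g : M -> A * B) :
  cancel (@mul_map M A B) g ->
  forall (m : M) (a : A) (b : B),
    m = val a * val b -> val (g m).1 = val a /\ val (g m).2 = val b.
Proof. by move=> fK m a b ->; rewrite (fK (a, b)). Qed.

(* With l, r satisfying (i)-(iii), l (a b) = a and r (a b) = b; in particular
   m and l(m) r(m) have the same images under l and r, so (iv) identifies them. *)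
Theorem theorem2p13 (M : monoidType) (A B : set M)
    (hA : monoid_closed (mem A)) (hB : monoid_closed (mem B)) :
  factorized A B <->
  exists (l : M -> A) (r : M -> B),
    [/\ forall (a : A) (m : M), val (l (val a * m)) = val a * val (l m),
        forall (m : M) (b : B), val (r (m * val b)) = val (r m) * val b,
        (forall a : A, val (r (val a)) = 1) /\
        (forall b : B, val (l (val b)) = 1)
      & kernel_pair l `&` kernel_pair r = kernel_pair (@id M)].
Proof.
have [A1 AM] := hA; have [B1 BM] := hB; split.
  case=> g fK gK.
  have comp := @bijective_mul_map_components M A B g fK.
  have dec m : m = val (g m).1 * val (g m).2 by rewrite -[LHS]gK.
  exists (fun m => (g m).1), (fun m => (g m).2); split.
  - move=> a m; set a' := (g m).1.
    (* As A is closed under products, a m = (a l(m)) r(m) is a factorization, so uniqueness yields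
       l(a m). *)
    have inA : val a * val a' \in A by apply: AM; apply: valP.
    have [] // := comp (val a * m) (SigSub inA) (g m).2.
    by rewrite {1}(dec m) mulgA.
  - move=> m b; set b' := (g m).2.
    have inB : val b' * val b \in B by apply: BM; apply: valP.
    have [] // := comp (m * val b) (g m).1 (SigSub inB).
    by rewrite {1}(dec m) mulgA.
  (* Factor a = a 1 and b = 1 b, with 1 in both submonoids. *)
  - split=> [a|b].
    + by have [] // := comp (val a) a (SigSub B1); rewrite mulg1.
    + by have [] // := comp (val b) (SigSub A1) b; rewrite mul1g.
  (* Since m = l(m) r(m), the two images determine m. *)
  - apply/seteqP; split=> -[x y]; rewrite /kernel_pair /=.
      by move=> [eql eqr]; rewrite (dec x) (dec y) eql eqr.
    by move=> ->.
case=> l [r [lM rM [r1 l1] lrK]].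
(* By (i) and (iii), l(a b) = a l(b) = a. *)
have lK (a : A) (b : B) : l (val a * val b) = a.
  by apply: val_inj; rewrite lM l1 mulg1.
have rK (a : A) (b : B) : r (val a * val b) = b.
  by apply: val_inj; rewrite rM r1 mul1g.
exists (fun m => (l m, r m)) => [[a b]|m]; first by rewrite /mul_map lK rK.
have : (kernel_pair l `&` kernel_pair r) (val (l m) * val (r m), m).
  by split; rewrite /kernel_pair /= ?lK ?rK.
by rewrite lrK.
Qed.
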